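(* Let $G$ be a graph on the vertex set $\{x_1,\ldots,x_h\}$, let $n_1,\ldots,n_h$ be positive integers, and let $\mathcal{H}=\bigcup_{1\le i\le h}\{H_i^1,\ldots,H_i^{n_i}\}$, where each $H_i^j$ is a complete graph on $m_{i,j}\ge1$ vertices, so that $G\circ\mathcal{H}$ is a multi-clique corona graph. Let $G'$ be the multi-whisker graph associated with $G\circ\mathcal{H}$ as defined in the context, and let $S=\Bbbk[V(G\circ\mathcal{H})]$ and $S'=\Bbbk[V(G')]$. Then $$\beta_{p,q}(S/I(G\circ\mathcal{H}))=\beta_{p,q}(S'/I(G'))\quad\text{for all } p,q.$$
   Context: All graphs are finite, simple and undirected. $\Bbbk$ is an arbitrary field. For a graph $G$, $I(G)=(xy : \{x,y\}\in E(G))\subset\Bbbk[V(G)]$ is the edge ideal, and $\beta_{p,q}(M)$ denotes the $(p,q)$-th graded Betti number of a finitely generated graded module $M$ over the relevant standard graded polynomial ring. Multi-clique corona graph: $G\circ\mathcal{H}$ is the disjoint union of $G$ and all the complete graphs $H_i^j$ ($1\le i\le h$, $1\le j\le n_i$; pairwise disjoint vertex sets), with additional edges joining each $x_i$ to all vertices of $H_i^j$ for every $j=1,\ldots,n_i$. The graph $G'$: write $V(H_i^j)=\{y_{i,j,1},\ldots,y_{i,j,m_{i,j}}\}$, and introduce new vertices $z_{i,j,k}$ for $1\le i\le h$, $1\le j\le n_i$, $0\le k\le m_{i,j}-1$. Let $L=\{y_{i,j,m_{i,j}} : 1\le i\le h,\ 1\le j\le n_i\}$ (one vertex from each clique). Then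 $$V(G')=(V(G\circ\mathcal{H})\setminus L)\cup\{z_{i,j,k}\},$$ and $E(G')$ consists of all edges of the induced subgraph $(G\circ\mathcal{H})-L$, together with the edges $\{x_i,z_{i,j,0}\}$ for all $i,j$ and the edges $\{y_{i,j,k},z_{i,j,k}\}$ for all $i,j$ and $1\le k\le m_{i,j}-1$. (Thus $G'$ is obtained from the graph $(G\circ\mathcal{H})-L$ by attaching $n_i$ pendant edges at each $x_i$ and one pendant edge at each remaining $y_{i,j,k}$.) *)

(* Defs.v *)
From HB Require Import structures.
From mathcomp Require Import all_boot all_order all_algebra.
From mathcomp Require Import boolp classical_sets.
From mathcomp.multinomials Require Import mpoly.

Set Implicit Arguments.
Unset Strict Implicit.
Unset Printing Implicit Defensive.

Import GRing.Theory.
Local Open Scope ring_scope.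
Local Open Scope quotient_scope.

Section QuotientModule.
Variables (R : comNzRingType) (I : idealr R).
Local Notation Q := {ideal_quot I}.

Definition quot_scale (a : R) (x : Q) : Q := \pi_Q a * x.

Lemma quot_scaleA a b x : quot_scale a (quot_scale b x) = quot_scale (a * b) x.
Proof. by rewrite /quot_scale rmorphM mulrA. Qed.

Lemma quot_scale1 : left_id 1 quot_scale.
Proof. by move=> x; rewrite /quot_scale rmorph1 mul1r. Qed.

Lemma quot_scaleDr : right_distributive quot_scale +%R.
Proof. by move=> a x y; rewrite /quot_scale mulrDr. Qed.

Lemma quot_scaleDl x : {morph quot_scale^~ x : a b / a + b}.
Proof. by move=> a b; rewrite /quot_scale rmorphD mulrDl. Qed.

HB.instance Definition _ := GRing.Zmodule_isLmodule.Build R (Quotient.quot I)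
  quot_scaleA quot_scale1 quot_scaleDr quot_scaleDl.

End QuotientModule.

Section Betti.
Variables (k : fieldType) (n : nat).
Local Notation S := {mpoly k[n]}.

(* The grading of [M] is given by its components: [gr d x] means that [x]
   belongs to the component of degree [d]. *)
Variables (M : lmodType S) (gr : nat -> M -> Prop).

(* The data of a complex F of graded free S-modules of finite rank with an
   augmentation to M.  F_p has a basis indexed by ['I_(rk p)] whose i-th
   element has degree [gdeg p i], so that F_p is the direct sum of the
   S(- gdeg p i).  Elements of F_p are row vectors, and the differential
   F_(p+1) -> F_p is u |-> u *m diff p. *)
Record augmented_free := AugmentedFree {
  rk : nat -> nat;
  gdeg : forall p, 'I_(rk p) -> nat;
  diff : forall p, 'M[S]_(rk p.+1, rk p);
  aug : 'I_(rk 0) -> M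
}.

Arguments rk : clear implicits.
Arguments diff : clear implicits.

Definition augmap (F : augmented_free) (u : 'rV[S]_(rk F 0)) : M :=
  \sum_i u 0 i *: aug i.

Arguments augmap : clear implicits.

Record is_minimal_resolution (F : augmented_free) : Prop := {
  aug_graded : forall i : 'I_(rk F 0), gr (gdeg i) (aug i);
  (* An entry of the differential is homogeneous of degree
     gdeg i - gdeg j, and zero if this difference is negative. *)
  diff_graded : forall p (i : 'I_(rk F p.+1)) (j : 'I_(rk F p)),
    {in msupp (diff F p i j), forall m, (gdeg j + mdeg m = gdeg i)%N};
  aug_surjective : forall x : M, exists u, augmap F u = x;
  exact_at0 : forall u : 'rV[S]_(rk F 0),
    augmap F u = 0 <-> exists v, v *m diff F 0 = u;
  exact_atS : forall p (u : 'rV[S]_(rk F p.+1)),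
    u *m diff F p = 0 <-> exists v, v *m diff F p.+1 = u;
  (* im (F_(p+1) -> F_p) is contained in m F_p, m = (X_1, ..., X_n). *)
  diff_minimal : forall p (i : 'I_(rk F p.+1)) (j : 'I_(rk F p)),
    (diff F p i j)@_0%MM = 0
}.

(* The exponent of S(-q) in F_p, F the minimal graded free resolution of M.
   For M finitely generated, F exists and is unique up to isomorphism, so that
   the set below is a singleton and the default value 0 is not used. *)
Definition betti (p q : nat) : nat :=
  xget 0%N [set b : nat | exists F : augmented_free,
    is_minimal_resolution F /\
    b = #|[pred i : 'I_(rk F p) | gdeg i == q]|]%classic.

End Betti.

(* The grading of S/I induced by the standard grading of S. *)
Definition quot_gr (k : fieldType) (n : nat) (I : idealr {mpoly k[n]})
    (d : nat) (x : {ideal_quot I}) : Prop :=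
  exists2 f : {mpoly k[n]}, f \is d.-homog & \pi_{ideal_quot I} f = x.

Record sgraph (V : finType) := SGraph {
  adj :> rel V;
  adj_sym : ssrbool.symmetric adj;
  adj_irr : irreflexive adj
}.

Section EdgeIdeal.
Variables (k : fieldType) (V : finType) (G : sgraph V).
Local Notation S := {mpoly k[#|V|]}.

Definition var (v : V) : S := 'X_(enum_rank v).

(* The boolean membership predicate, obtained by classical logic, of the ideal
   generated by the products x y for x, y adjacent. *)
Definition edge_ideal : {pred S} := fun f : S =>
  `[< exists c : V * V -> S,
        f = \sum_(e : V * V | G e.1 e.2) c e * (var e.1 * var e.2) >].

Lemma edge_idealP (f : S) :
  reflect (exists c : V * V -> S,
             f = \sum_(e : V * V | G e.1 e.2) c e * (var e.1 * var e.2))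
          (f \in edge_ideal).
Proof. exact: asboolP. Qed.

Lemma edge_ideal_closed : idealr_closed edge_ideal.
Proof.
split.
- apply/edge_idealP; exists (fun=> 0).
  by rewrite big1 // => e _; rewrite mul0r.
- apply/negP => /edge_idealP [c /(congr1 (meval (fun=> 0)))].
  rewrite rmorph1 rmorph_sum big1 => [/eqP|e _]; first by rewrite oner_eq0.
  by rewrite /= !rmorphM /= /var mevalXU mul0r mulr0.
- move=> a f g /edge_idealP [c ->] /edge_idealP [d ->].
  apply/edge_idealP; exists (fun e => a * c e + d e).
  rewrite mulr_sumr -big_split /=.
  by apply: eq_bigr => e _; rewrite mulrDl -mulrA.
Qed.

HB.instance Definition _ := isIdealr.Build S edge_ideal edge_ideal_closed.

(* beta_{p,q}(S/I(G)) over S = k[V]. *)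
Definition betti_edge_ring (p q : nat) : nat :=
  betti (@quot_gr k #|V| [the idealr S of edge_ideal]) p q.

End EdgeIdeal.

Section Corona.
Variables (h : nat) (G : sgraph 'I_h) (n : 'I_h -> nat).

(* The index (i, j) of the clique H_i^j; [tag c] is i. *)
Definition clique_index := {i : 'I_h & 'I_(n i)}.

Variable m : clique_index -> nat.

(* [Tagged _ k] with tag c = (i, j) is y_(i,j,k+1): the vertices of a clique
   are numbered here from 0 to m c - 1, and not from 1 to m c. *)
Definition clique_vertex := {c : clique_index & 'I_(m c)}.

(* [inl i] is x_i. *)
Definition corona_vertex : finType := ('I_h + clique_vertex)%type.

Definition corona_adj : rel corona_vertex := fun u v =>
  match u, v with
  | inl i, inl i' => G i i'
  | inl i, inr y | inr y, inl i => tag (tag y) == i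
  | inr y, inr y' => (tag y == tag y') && (y != y')
  end.

Lemma corona_adj_sym : ssrbool.symmetric corona_adj.
Proof.
move=> [i|y] [i'|y'] //=; first exact: adj_sym.
by rewrite eq_sym [y == _]eq_sym.
Qed.

Lemma corona_adj_irr : irreflexive corona_adj.
Proof. by move=> [i|y] /=; rewrite ?adj_irr ?eqxx. Qed.

Definition corona : sgraph corona_vertex :=
  SGraph corona_adj_sym corona_adj_irr.

(* The set L of the last vertices y_(i,j,m_(i,j)) of the cliques. *)
Definition last_vertices : {set corona_vertex} :=
  [set v : corona_vertex |
    if v is inr y then (tagged y).+1 == m (tag y) else false].

(* [inl v] is a vertex of the corona outside L; [inr z] with z = Tagged _ k and
   tag z = (i, j) is the new vertex z_(i,j,k), where 0 <= k <= m_(i,j) - 1. *)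
Definition whisker_vertex : finType :=
  ({v : corona_vertex | v \notin last_vertices} +
   {c : clique_index & 'I_(m c)})%type.

(* Since the clique vertices are numbered from 0, z_(i,j,k) with k >= 1 is
   attached to the clique vertex of number k - 1. *)
Definition pendant (v : corona_vertex)
    (z : {c : clique_index & 'I_(m c)}) : bool :=
  match v with
  | inl i => (tag (tag z) == i) && (tagged z == 0 :> nat)
  | inr y => (tag y == tag z) && ((tagged y).+1 == tagged z :> nat)
  end.

Definition whisker_adj : rel whisker_vertex := fun u v =>
  match u, v with
  | inl a, inl b => corona (val a) (val b)
  | inl a, inr z | inr z, inl a => pendant (val a) z
  | inr _, inr _ => false
  end.

Lemma whisker_adj_sym : ssrbool.symmetric whisker_adj.
Proof. by move=> [a|z] [b|z'] //=; exact: corona_adj_sym. Qed.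

Lemma whisker_adj_irr : irreflexive whisker_adj.
Proof. by move=> [a|z] //=; exact: corona_adj_irr. Qed.

Definition whisker : sgraph whisker_vertex :=
  SGraph whisker_adj_sym whisker_adj_irr.

End Corona.

(* Main.v *)
Require Import Defs.
From HB Require Import structures.
From mathcomp Require Import all_boot all_order all_algebra.
From mathcomp Require Import boolp classical_sets.
From mathcomp.multinomials Require Import mpoly.

(** The substitution that sends every z_(i,j,k) to the last vertex
    y_(i,j,m_(i,j)) of the clique H_i^j folds G' onto the corona: the whisker
    x_i z_(i,j,0) becomes the edge x_i y_(i,j,m), and the whisker
    y_(i,j,k) z_(i,j,k) becomes the edge y_(i,j,k) y_(i,j,m), so that I(G') is
    mapped onto the edge ideal of the corona.  The Betti numbers do not change
    because the substitution can be carried out by identifying two vertices at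
    a time, and each of these identifications divides S by a linear form
    theta = X_a - X_b that is regular on S and on S/I.

    Regularity is combinatorial ([edge_ideal_regular]): if the neighbours of a
    are all adjacent to the neighbours of b, then no minimal vertex cover
    contains both a and b, and so theta lies in no associated prime of the edge
    ideal.  Here the condition holds since two whiskers z_(i,j,k), z_(i,j,l)
    hang from distinct vertices of the clique {x_i, y_(i,j,1), ...,
    y_(i,j,m-1)}, and it is inherited by the graph obtained by merging a and b
    ([betti_identification]).

    Let phi : S -> T = S/theta, let I be an ideal of S on which theta is
    regular, and J = phi(I).  A minimal graded free resolution of S/I reduces
    modulo theta to one of T/J, and conversely a minimal resolution of T/J
    lifts to one of S/I of the same ranks and degrees: a homogeneous lift of
    the generators of each syzygy module generates the lifted syzygy module, by
    the graded Nakayama lemma ([graded_nakayama], [lift_exact],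
    [reduce_exact]).  Hence the same ranks and degrees occur for the minimal
    resolutions of S/I and of T/J, and both Betti numbers are read off from
    them ([betti_hyperplane_section]). *)

Set Implicit Arguments.
Unset Strict Implicit.
Unset Printing Implicit Defensive.

Import GRing.Theory.
Local Open Scope ring_scope.

(** * Graded pieces and the graded Nakayama lemma *)

Lemma mpoly_ind_linear (k : fieldType) n (P : {mpoly k[n]} -> Prop) :
  P 0 -> (forall p q, P p -> P q -> P (p + q)) ->
  (forall c m, P (c *: 'X_[m])) -> forall p, P p.
Proof. by move=> P0 PD PX; apply: mpolyind => // c m p _ _; exact: PD. Qed.

Section GradedRows.
Variables (k : fieldType) (n : nat).
Local Notation S := {mpoly k[n]}.

(** The component of degree e of f as an element of S(- a). *)
Definition piece (a e : nat) (f : S) : S :=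
  if (a <= e)%N then pihomog mdeg (e - a) f else 0.

Lemma piece_is_linear a e : linear (piece a e).
Proof.
move=> c f g; rewrite /piece; case: ifP => _; first by rewrite linearP.
by rewrite scaler0 addr0.
Qed.

HB.instance Definition _ a e := GRing.isLinear.Build k S S _ (piece a e)
  (piece_is_linear a e).

Lemma pieceX a e m :
  piece a e 'X_[m] = if (a + mdeg m == e)%N then 'X_[m] else 0.
Proof.
rewrite /piece; case: leqP => [le_ae|lt_ea]; last first.
  by rewrite gtn_eqF // ltn_addr.
by rewrite pihomogX -(inj_eq (@addnI a)) subnKC.
Qed.

Lemma mcoeff_piece a e f m :
  (piece a e f)@_m = if (a + mdeg m == e)%N then f@_m else 0.
Proof.
elim/mpoly_ind_linear: f => [|f g IHf IHg|c m'].
- by rewrite linear0 mcoeff0 if_same.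
- by rewrite linearD !mcoeffD IHf IHg; case: ifP; rewrite // addr0.
rewrite linearZ /= pieceX !mcoeffZ mcoeffX.
case: (eqVneq m' m) => [->|/negbTE ne].
  by case: ifP; rewrite ?mcoeffX ?eqxx ?mcoeff0 ?mulr0.
by rewrite mulr0 if_same; case: ifP; rewrite ?mcoeffX ?ne ?mcoeff0 mulr0.
Qed.

Lemma piece_sum a f N : (a + msize f <= N)%N -> \sum_(e < N) piece a e f = f.
Proof.
move=> le_N; apply/mpolyP => m; rewrite raddf_sum /=.
under eq_bigr do rewrite mcoeff_piece.
have [m_f|m_f] := boolP (m \in msupp f); last first.
  by rewrite big1 memN_msupp_eq0 // => i _; rewrite if_same.
have lt_m : (a + mdeg m < N)%N.
  by apply: leq_trans le_N; rewrite ltn_add2l msize_mdeg_lt.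
rewrite (bigD1 (Ordinal lt_m)) //= eqxx big1 ?addr0 // => i ne_i.
by case: ifP => // /eqP def_i; case/eqP: ne_i; apply: val_inj.
Qed.

(** The entries of a graded map S(- a) -> S(- b): homogeneous of degree a - b,
    and zero if b exceeds a. *)
Definition has_shift (a b : nat) (f : S) : Prop :=
  {in msupp f, forall m, (b + mdeg m = a)%N}.

Lemma has_shiftP a b f : has_shift a b f <-> piece b a f = f.
Proof.
split=> [hf|hf m].
  apply/mpolyP => m; rewrite mcoeff_piece; case: eqP => // ne.
  by case: (boolP (m \in msupp f)) => [/hf //|/memN_msupp_eq0 ->].
rewrite mcoeff_msupp -hf mcoeff_piece.
by case: (eqVneq _ a) => // _; rewrite eqxx.
Qed.

Lemma has_shift_piece a b f : has_shift a b (piece b a f).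
Proof.
apply/has_shiftP/mpolyP => m; rewrite !mcoeff_piece.
by case: (_ == _).
Qed.

Lemma pieceM a b e f g : has_shift a b g ->
  piece b e (f * g) = piece a e f * g.
Proof.
move/has_shiftP => <-.
elim/mpoly_ind_linear: f => [|f f' IHf IHf'|c m].
- by rewrite mul0r !linear0 mul0r.
- by rewrite mulrDl !linearD /= mulrDl IHf IHf'.
rewrite -scalerAl !linearZ /= -scalerAl; congr (_ *: _).
elim/mpoly_ind_linear: g => [|g g' IHg IHg'|c' m'].
- by rewrite linear0 !mulr0 linear0.
- by rewrite linearD !mulrDr linearD /= IHg IHg'.
rewrite linearZ /= -!scalerAr linearZ /=; congr (_ *: _).
rewrite !pieceX; case: eqP => [<-|_]; last by rewrite !mulr0 linear0.
rewrite -mpolyXD pieceX mdegD addnCA [in RHS]addnC.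
by case: ifP; rewrite ?mul0r ?mpolyXD.
Qed.

(** The component of degree e of u in the sum of the S(- g i). *)
Definition hpart r (g : 'I_r -> nat) (e : nat) (u : 'rV[S]_r) : 'rV[S]_r :=
  \row_i piece (g i) e (u 0 i).

Definition graded_mx r s (gr : 'I_r -> nat) (gs : 'I_s -> nat)
    (D : 'M[S]_(r, s)) : Prop :=
  forall i j, has_shift (gr i) (gs j) (D i j).

Lemma hpartD r (g : 'I_r -> nat) e : {morph hpart g e : u v / u + v}.
Proof. by move=> u v; apply/rowP => i; rewrite !mxE linearD. Qed.

Lemma hpart_mulmx r s (gr : 'I_r -> nat) (gs : 'I_s -> nat) D e u :
  graded_mx gr gs D -> hpart gs e (u *m D) = hpart gr e u *m D.
Proof.
move=> hD; apply/rowP => j; rewrite !mxE linear_sum /=.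
by apply: eq_bigr => i _; rewrite (pieceM _ _ (hD i j)) mxE.
Qed.

Lemma hpart_sum r (g : 'I_r -> nat) u : exists N, u = \sum_(e < N) hpart g e u.
Proof.
have [N leN] : exists N, forall i, (g i + msize (u 0%R i) <= N)%N.
  by exists (\max_i (g i + msize (u 0%R i)))%N => i; exact: leq_bigmax.
exists N; apply/rowP => i; rewrite summxE -[LHS](piece_sum (leN i)).
by apply: eq_bigr => e _; rewrite mxE.
Qed.

Lemma hpart_scale_linear r (g : 'I_r -> nat) theta e u : has_shift 1 0 theta ->
  hpart g e (theta *: u) = if e is e'.+1 then theta *: hpart g e' u else 0.
Proof.
move=> htheta; apply/rowP => i.
have {}htheta : has_shift (g i).+1 (g i) theta.
  by move=> m /htheta; rewrite add0n => ->; rewrite addn1.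
rewrite !mxE mulrC (pieceM _ _ htheta).
by case: e => [|e]; rewrite !mxE /piece /= ?ltnS ?subSS ?mul0r // mulrC.
Qed.

(** The component of degree e of theta w is theta times the component of degree
    e - 1 of w, so K = N + theta K puts every component of an element of K in N
    by induction on the degree. *)
Lemma graded_nakayama r (g : 'I_r -> nat) (theta : S)
    (K N : 'rV[S]_r -> Prop) :
  has_shift 1 0 theta ->
  N 0 -> (forall u v, N u -> N v -> N (u + v)) ->
  (forall u, N u -> N (theta *: u)) -> (forall e u, N u -> N (hpart g e u)) ->
  (forall u, K u -> exists v w, [/\ N v, K w & u = v + theta *: w]) ->
  forall u, K u -> N u.
Proof.
move=> htheta N0 ND Ntheta Npart KN.
have Npiece e : forall u, K u -> N (hpart g e u).
  elim: e => [|e IHe] u /KN[v [w [Nv Kw ->]]];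
    rewrite hpartD (hpart_scale_linear _ _ _ htheta).
    by apply: ND => //; exact: Npart.
  by apply: ND; [exact: Npart | exact/Ntheta/IHe].
move=> u Ku; have [d ->] := hpart_sum g u.
by elim/big_ind: _ => // e _; exact: Npiece.
Qed.
End GradedRows.

(** * Reduction modulo a linear form, one differential at a time *)

Section Specialization.
Variables (k : fieldType) (n n' : nat).
Local Notation S := {mpoly k[n]}.
Local Notation T := {mpoly k[n']}.
Variables (phi : {rmorphism S -> T}) (theta : S).

(** phi identifies T with S/theta as graded rings.  The value theta = 0 is
    allowed and makes phi an isomorphism: this covers the renaming of the
    variables together with the genuine hyperplane sections. *)
Record is_hyperplane_section : Prop := {
  phi_surj : forall g, exists f, phi f = g;
  phi_piece : forall a e f, phi (piece a e f) = piece a e (phi f);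
  phi_const : forall f, (phi f)@_0%MM = f@_0%MM;
  phi_ker : forall f, phi f = 0 -> exists g, f = theta * g;
  phi_theta : phi theta = 0;
  theta_linear : has_shift 1 0 theta
}.

Hypothesis hphi : is_hyperplane_section.

Local Notation "A ^phi" := (map_mx phi A) (at level 2, format "A ^phi").

Lemma lift_mx r s (A : 'M[T]_(r, s)) : exists B, B^phi = A.
Proof.
have [f hf] := choice (phi_surj hphi).
by exists (map_mx f A); apply/matrixP => i j; rewrite !mxE hf.
Qed.

(** Choosing w = 0 when theta = 0 lets one cancel theta from an equation
    theta (w D) = 0 in every case. *)
Lemma map_row_eq0 r (u : 'rV[S]_r) : u^phi = 0 ->
  exists w, u = theta *: w /\ (theta = 0 -> w = 0).
Proof.
move=> u0; have [/eqP th0|th0] := boolP (theta == 0).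
  exists 0; rewrite scaler0; split=> //; apply/rowP => i.
  have /rowP/(_ i) := u0; rewrite !mxE => /(phi_ker hphi)[g ->].
  by rewrite th0 mul0r.
have ker i : exists g, u 0 i = theta * g.
  by apply: (phi_ker hphi); have /rowP/(_ i) := u0; rewrite !mxE.
have [g hg] := choice ker.
exists (\row_i g i); split; last by move/eqP; rewrite (negbTE th0).
by apply/rowP => i; rewrite !mxE -hg.
Qed.

Lemma map_hpart r (g : 'I_r -> nat) e u : (hpart g e u)^phi = hpart g e u^phi.
Proof. by apply/rowP => i; rewrite !mxE (phi_piece hphi). Qed.

Lemma map_graded r s (gr : 'I_r -> nat) (gs : 'I_s -> nat) D :
  graded_mx gr gs D -> graded_mx gr gs D^phi.
Proof.
move=> hD i j; apply/has_shiftP; rewrite mxE -(phi_piece hphi).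
by congr (phi _); exact/has_shiftP.
Qed.

Lemma lift_graded r s (gr : 'I_r -> nat) (gs : 'I_s -> nat)
    (D : 'M[T]_(r, s)) :
  graded_mx gr gs D -> exists2 D', D'^phi = D & graded_mx gr gs D'.
Proof.
move=> hD; have [D' hD'] := lift_mx D.
exists (\matrix_(i, j) piece (gs j) (gr i) (D' i j)).
  apply/matrixP => i j; rewrite !mxE (phi_piece hphi).
  have /matrixP/(_ i j) := hD'; rewrite mxE => ->.
  exact/has_shiftP.
by move=> i j; rewrite mxE; exact: has_shift_piece.
Qed.

(** B is a graded submodule of a free module F over S, C is its image modulo
    theta, and theta is regular on F/B.  Two pairs occur: the ideals (I, J) in
    rank one, as the place where the augmentation lands, and (0, 0), for the
    differentials. *)
Record is_regular_pair s (gs : 'I_s -> nat) (B : 'rV[S]_s -> Prop)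
    (C : 'rV[T]_s -> Prop) : Prop := {
  pair_lin : forall a u v, B u -> B v -> B (a *: u + v);
  pair0 : B 0;
  pair_graded : forall e u, B u -> B (hpart gs e u);
  pair_reg : theta != 0 -> forall u, B (theta *: u) -> B u;
  pair_image : forall c, C c <-> exists2 b, B b & b^phi = c
}.

Section Stage.
Variables (r s : nat) (gr : 'I_r -> nat) (gs : 'I_s -> nat).
Variables (D : 'M[S]_(r, s)) (B : 'rV[S]_s -> Prop) (C : 'rV[T]_s -> Prop).
Hypotheses (hD : graded_mx gr gs D) (hB : is_regular_pair gs B C).

(** An element u D of B + theta F lies in B + theta Im D.  With theta regular on
    F/B, this says that theta is regular on F/(B + Im D), or equivalently that
    Tor_1(F/(B + Im D), S/theta) = 0. *)
Definition tor_independent : Prop :=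
  forall u, C (u *m D)^phi -> exists w, B (u *m D - theta *: (w *m D)).

(** If u D = b + theta (w D), then u - theta w lies in the kernel of D modulo B,
    and it has the same reduction as u. *)
Lemma lift_kernel : tor_independent ->
  forall u : 'rV_r, C (u *m D^phi) -> exists2 v, B (v *m D) & v^phi = u.
Proof.
move=> hT u; have [v <-] := lift_mx u.
rewrite -map_mxM => /hT[w hw]; exists (v - theta *: w).
  by rewrite mulmxBl -scalemxAl.
by rewrite map_mxB map_mxZ (phi_theta hphi) scale0r subr0.
Qed.

(** The kernel K of D modulo B satisfies K :&: theta S^r = theta K, since theta
    is regular on F/B. *)
Lemma kernel_mod_theta u : B (u *m D) -> u^phi = 0 ->
  exists2 w, B (w *m D) & u = theta *: w.
Proof.
move=> Bu /map_row_eq0[w [def_u w0]]; exists w => //.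
have [/eqP/w0->|th0] := boolP (theta == 0).
  by rewrite mul0mx; exact: pair0 hB.
by apply: (pair_reg hB th0); rewrite scalemxAl -def_u.
Qed.

Lemma reduce_exact t (E : 'M[S]_(t, r)) : tor_independent ->
  (forall u, B (u *m D) <-> exists v, v *m E = u) ->
  forall u, C (u *m D^phi) <-> exists v, v *m E^phi = u.
Proof.
move=> hT hE u; split=> [/(lift_kernel hT)[v /hE[w <-] <-]|[v <-]].
  by exists w^phi; rewrite map_mxM.
have [w <-] := lift_mx v; apply/(pair_image hB).
by exists (w *m E *m D); [apply/hE; exists w | rewrite !map_mxM].
Qed.

(** The rows of E generate the reduced kernel.  Their lifts to the kernel K may
    be taken homogeneous because K is graded; they generate K modulo
    K :&: theta S^r = theta K, hence they generate K by Nakayama's lemma. *)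
Lemma lift_exact t (gt : 'I_t -> nat) (E : 'M[T]_(t, r)) : tor_independent ->
  graded_mx gt gr E ->
  (forall u, C (u *m D^phi) <-> exists v, v *m E = u) ->
  exists E', [/\ E'^phi = E, graded_mx gt gr E' &
    forall u, B (u *m D) <-> exists v, v *m E' = u].
Proof.
move=> hT hE exE.
have lift_row i : exists2 e : 'rV_r, B (e *m D) & e^phi = row i E.
  by apply: (lift_kernel hT); apply/exE; exists (delta_mx 0 i); rewrite rowE.
have lift_row_graded i : exists e : 'rV_r,
    [/\ B (e *m D), e^phi = row i E & hpart gr (gt i) e = e].
  have [e Be de] := lift_row i; exists (hpart gr (gt i) e); split.
  - by rewrite -(hpart_mulmx _ _ hD); exact: pair_graded hB _ _ Be.
  - by rewrite map_hpart de; apply/rowP => j; rewrite !mxE; exact/has_shiftP.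
  - by apply/rowP => j; rewrite !mxE; exact/has_shiftP/has_shift_piece.
have [f hf] := choice lift_row_graded.
pose E' := \matrix_i f i; have rowf i : row i E' = f i by rewrite rowK.
have sumE v : v *m E' = \sum_i v 0 i *: f i.
  by rewrite mulmx_sum_row; apply: eq_bigr => i _; rewrite rowf.
have BE' v : B (v *m E' *m D).
  rewrite sumE mulmx_suml; elim/big_ind: _ => [|x y Bx By|i _].
  - exact: pair0 hB.
  - by rewrite -[x]scale1r; exact: pair_lin hB _ _ _ Bx By.
  - rewrite -scalemxAl -[X in B X]addr0.
    by apply: (pair_lin hB) (pair0 hB); have [] := hf i.
have mapE' : E'^phi = E.
  by apply/row_matrixP => i; rewrite -map_row rowf; have [] := hf i.
have gradedE' : graded_mx gt gr E'.
  move=> i j; apply/has_shiftP; have [_ _ /rowP/(_ j)] := hf i.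
  by rewrite !mxE.
exists E'; split=> // u; split=> [|[v <-]]; last exact: BE'.
apply: (@graded_nakayama _ _ _ gr theta (fun u => B (u *m D))
         (fun u => exists v, v *m E' = u)) (theta_linear hphi) _ _ _ _ _ u.
- by exists 0; rewrite mul0mx.
- by move=> _ _ [v <-] [w <-]; exists (v + w); rewrite mulmxDl.
- by move=> _ [v <-]; exists (theta *: v); rewrite scalemxAl.
- move=> e _ [v <-]; exists (hpart gt e v).
  by rewrite (hpart_mulmx _ _ gradedE').
move=> x Bx; have /exE[v hv] : C (x^phi *m D^phi).
  by apply/(pair_image hB); exists (x *m D); rewrite ?map_mxM.
have [v' def_v] := lift_mx v.
have [|| w Bw hw] := @kernel_mod_theta (x - v' *m E').
- rewrite mulmxBl addrC -scaleN1r; exact: pair_lin hB _ _ _ (BE' _) Bx.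
- by rewrite map_mxB map_mxM mapE' def_v hv subrr.
by exists (v' *m E'), w; split; [exists v' | | rewrite -hw addrC subrK].
Qed.
End Stage.

(** Hands the condition on to the next differential: theta is regular modulo
    Im E because Im E is the kernel of a map into F/B, where it is regular. *)
Lemma tor_independent_next r s t (gs : 'I_s -> nat) (D : 'M[S]_(r, s)) B C
    (E : 'M[S]_(t, r)) :
  is_regular_pair gs B C -> (forall u, B (u *m D) <-> exists v, v *m E = u) ->
  tor_independent E (eq^~ 0) (eq^~ 0).
Proof.
move=> hB exE u hu.
have Bu : B (u *m E *m D) by apply/exE; exists u.
have [w /exE[v <-] ->] := kernel_mod_theta hB Bu hu.
by exists v; rewrite subrr.
Qed.

Lemma pair_zero s (gs : 'I_s -> nat) : is_regular_pair gs (eq^~ 0) (eq^~ 0).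
Proof.
split=> [a _ _ -> ->|//|e _ ->|th0 u hu|c].
- by rewrite scaler0 addr0.
- by apply/rowP => i; rewrite !mxE linear0.
- apply/rowP => i; rewrite mxE; have /rowP/(_ i)/eqP := hu.
  by rewrite !mxE mulf_eq0 (negbTE th0) => /eqP.
- by split=> [->|[_ -> <-]]; [exists 0|]; rewrite ?map_mx0.
Qed.
End Specialization.

(** * Reduction and lifting of minimal resolutions *)

Lemma dependent_choice_nat (X : nat -> Type) (P : forall p, X p -> Prop)
    (R : forall p, X p -> X p.+1 -> Prop) (x0 : X 0%N) :
  P 0%N x0 -> (forall p x, P p x -> exists2 y, P p.+1 y & R p x y) ->
  exists f : forall p, X p,
    [/\ f 0%N = x0, forall p, P p (f p) & forall p, R p (f p) (f p.+1)].
Proof.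
move=> P0 step.
have next p (x : {x : X p | P p x}) :
    {y : {y : X p.+1 | P p.+1 y} | R p (sval x) (sval y)}.
  case: x => x Px; have [y Py Rxy] := cid2 (step p x Px).
  by exists (exist _ y Py).
pose f := nat_rect (fun p => {x : X p | P p x}) (exist _ x0 P0)
  (fun p x => sval (next p x)).
exists (fun p => sval (f p)); split=> // p; first exact: (svalP (f p)).
exact: (svalP (next p (f p))).
Qed.

Section IdealResolution.
Variables (k : fieldType) (n : nat).
Local Open Scope quotient_scope.
Local Notation S := {mpoly k[n]}.

Definition in_ideal (I : {pred S}) (u : 'rV[S]_1) : Prop := u 0 0 \in I.

(** A minimal resolution of S/I in which the augmentation is represented by a
    column A of polynomials, the images of the basis elements being their
    classes.  The augmentation can then be lifted and reduced like the
    differentials. *)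
Record is_ideal_resolution (I : {pred S}) (rk : nat -> nat)
    (gd : forall p, 'I_(rk p) -> nat) (A : 'cV[S]_(rk 0%N))
    (D : forall p, 'M[S]_(rk p.+1, rk p)) : Prop := {
  res_aug_graded : graded_mx (gd 0%N) (fun=> 0%N) A;
  res_graded : forall p, graded_mx (gd p.+1) (gd p) (D p);
  res_surj : forall x : 'rV_1, exists u, in_ideal I (x - u *m A);
  res_exact0 : forall u, in_ideal I (u *m A) <-> exists v, v *m D 0%N = u;
  res_exactS : forall p (u : 'rV_(rk p.+1)),
    u *m D p = 0 <-> exists v, v *m D p.+1 = u;
  res_minimal : forall p i j, (D p i j)@_0%MM = 0
}.

Variable I : idealr S.
Local Notation Q := {ideal_quot I}.

Lemma pi_eq0 (f : S) : (\pi_Q f = 0) <-> f \in I.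
Proof.
rewrite -[X in X \in _]subr0 Quotient.idealrBE.
by split=> [h|/eqP ->]; [apply/eqP; rewrite h|]; rewrite rmorph0.
Qed.

Lemma augmap_pi rk gd D (A : 'cV[S]_(rk 0%N)) u :
  augmap (F := @AugmentedFree k n Q rk gd D (fun i => \pi_Q (A i 0))) u
  = \pi_Q ((u *m A) 0 0).
Proof.
rewrite /augmap mxE rmorph_sum; apply: eq_bigr => i _.
by rewrite rmorphM.
Qed.

Lemma resolution_of_ideal rk gd A D : @is_ideal_resolution I rk gd A D ->
  is_minimal_resolution (@quot_gr k n I)
    (@AugmentedFree k n Q rk gd D (fun i => \pi_Q (A i 0))).
Proof.
move=> [hA hD surj ex0 exS min]; split=> //=.
- move=> i; exists (A i 0) => //; apply/dhomogP => m /(hA i 0).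
  by rewrite add0n.
- move=> x; have [u hu] := surj (const_mx (repr x)); exists u.
  rewrite augmap_pi; apply/esym/eqP; rewrite -subr_eq0 -[x]reprK.
  apply/eqP; rewrite -rmorphB; apply/pi_eq0.
  by move: hu; rewrite /in_ideal !mxE.
- by move=> u; rewrite augmap_pi pi_eq0; exact: ex0.
Qed.

Lemma ideal_of_resolution (F : augmented_free Q) :
  is_minimal_resolution (@quot_gr k n I) F ->
  exists A, @is_ideal_resolution I (rk F) (@gdeg _ _ _ F) A (@diff _ _ _ F).
Proof.
case: F => rk gd D aug [/= hA hD surj ex0 exS min].
have repr_aug i : exists a : S,
    a \is (gd 0%N i).-homog /\ \pi_Q a = aug i.
  by have [a] := hA i; exists a.
have [a ha] := choice repr_aug.
pose A := \col_i a i.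
have augE u : augmap (F := @AugmentedFree k n Q rk gd D aug) u
    = \pi_Q ((u *m A) 0 0).
  rewrite -(@augmap_pi rk gd D A); apply: eq_bigr => i _.
  by rewrite /= mxE (ha i).2.
exists A; split=> //.
- by move=> i j m; rewrite mxE => hm; rewrite add0n (dhomog_mf (ha i).1 hm).
- move=> x; have [u hu] := surj (\pi_Q (x 0 0)); exists u.
  rewrite /in_ideal 2!mxE; apply/pi_eq0.
  by rewrite rmorphB /= -augE hu subrr.
- by move=> u; rewrite -ex0 augE pi_eq0.
Qed.

End IdealResolution.

Lemma betti_ideal (k : fieldType) (n : nat) (I : idealr {mpoly k[n]}) p q :
  betti (@quot_gr k n I) p q =
  xget 0%N [set b : nat | exists rk gd A D,
    @is_ideal_resolution k n I rk gd A D /\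
    b = #|[pred i : 'I_(rk p) | gd p i == q]|]%classic.
Proof.
rewrite /betti; congr (xget _ _); apply/seteqP; split=> b /=.
  move=> [F [/ideal_of_resolution[A hA] ->]].
  by exists (rk F), (@gdeg _ _ _ F), A, (@diff _ _ _ F).
move=> [rk [gd [A [D [/resolution_of_ideal hF ->]]]]].
by eexists; split; first exact: hF.
Qed.

Section Towers.
Variables (k : fieldType) (n n' : nat).
Local Notation S := {mpoly k[n]}.
Local Notation T := {mpoly k[n']}.
Variables (phi : {rmorphism S -> T}) (theta : S).
Variables (I : idealr S) (J : idealr T).
Hypothesis hphi : is_hyperplane_section phi theta.
Hypothesis I_graded : forall e f, f \in I -> piece 0 e f \in I.
Hypothesis I_reg : theta != 0 -> forall f, theta * f \in I -> f \in I.
Hypothesis I_image : forall g, g \in J <-> exists2 f, f \in I & phi f = g.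
Local Notation "A ^phi" := (map_mx phi A) (at level 2, format "A ^phi").

Lemma pair_ideal :
  is_regular_pair phi theta (fun=> 0%N) (in_ideal I) (in_ideal J).
Proof.
split=> [a u v Iu Iv||e u Iu|th0 u|c].
- by rewrite /in_ideal !mxE rpredD // idealMr.
- by rewrite /in_ideal mxE rpred0.
- by rewrite /in_ideal mxE; exact: I_graded.
- by rewrite /in_ideal mxE; exact: I_reg.
split=> [/I_image[f If hf]|[b Ib <-]].
  exists (const_mx f); first by rewrite /in_ideal mxE.
  by apply/rowP => i; rewrite !mxE hf ord1.
by apply/I_image; exists (b 0 0) => //; rewrite mxE.
Qed.

(** Since S = I + Im A, any x with u A in I + theta x may be replaced by an
    element of Im A up to an element of I. *)
Lemma tor_independent_aug r (A : 'cV[S]_r) :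
  (forall x : 'rV_1, exists u, in_ideal I (x - u *m A)) ->
  tor_independent phi theta A (in_ideal I) (in_ideal J).
Proof.
move=> surj u /(pair_image pair_ideal)[b Ib hb].
have [|x [hx _]] := map_row_eq0 hphi (u := u *m A - b).
  by rewrite map_mxB hb subrr.
have [w Iw] := surj x; exists w.
rewrite -(subrK b (u *m A)) hx addrAC -scalerBr.
exact: pair_lin pair_ideal _ _ _ Iw Ib.
Qed.

Lemma reduce_surj r (A : 'cV[S]_r) :
  (forall x : 'rV_1, exists u, in_ideal I (x - u *m A)) ->
  forall x : 'rV_1, exists u, in_ideal J (x - u *m A^phi).
Proof.
move=> surj x; have [y <-] := lift_mx hphi x.
have [u Iu] := surj y; exists u^phi; apply/(pair_image pair_ideal).
by exists (y - u *m A); rewrite // map_mxB map_mxM.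
Qed.

(** Surjectivity modulo theta gives S = I + Im A + theta S, and Nakayama's lemma
    removes the last term. *)
Lemma lift_surj r (g : 'I_r -> nat) (A : 'cV[S]_r) :
  graded_mx g (fun=> 0%N) A ->
  (forall x : 'rV_1, exists u, in_ideal J (x - u *m A^phi)) ->
  forall x : 'rV_1, exists u, in_ideal I (x - u *m A).
Proof.
move=> hA surj x; have hI := pair_ideal.
apply: (@graded_nakayama _ _ _ (fun=> 0%N) theta (fun=> True)
  (fun x => exists u, in_ideal I (x - u *m A)))
  (theta_linear hphi) _ _ _ _ _ x Logic.I.
- by exists 0; rewrite mul0mx subrr; exact: pair0 hI.
- move=> u v [u' Iu] [v' Iv]; exists (u' + v').
  rewrite mulmxDl opprD addrACA -[_ - _]scale1r.
  exact: pair_lin hI _ _ _ Iu Iv.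
- move=> u [u' Iu]; exists (theta *: u').
  rewrite -scalemxAl -scalerBr -[X in in_ideal I X]addr0.
  exact: pair_lin hI _ _ _ Iu (pair0 hI).
- move=> e u [u' Iu]; exists (hpart g e u').
  rewrite -(hpart_mulmx _ _ hA) -scaleN1r.
  have hpartN (v : 'rV[S]_1) : hpart (fun=> 0%N) e (-1 *: v)
      = -1 *: hpart (fun=> 0%N) e v.
    by apply/rowP => i; rewrite !mxE !mulN1r linearN.
  rewrite -hpartN -hpartD scaleN1r; exact: pair_graded hI _ _ Iu.
move=> y _; have [u /(pair_image hI)[b Ib hb]] := surj y^phi.
have [v hv] := lift_mx hphi u.
have [|w [hw _]] := map_row_eq0 hphi (u := y - v *m A - b).
  by rewrite !map_mxB map_mxM hv hb subrr.
exists (y - theta *: w), w; split=> //; last by rewrite subrK.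
by exists v; rewrite addrAC -hw subKr.
Qed.

Lemma reduce_resolution rk gd A D : @is_ideal_resolution k n I rk gd A D ->
  @is_ideal_resolution k n' J rk gd A^phi (fun p => (D p)^phi).
Proof.
move=> [hA hD surj ex0 exS min]; have hT := tor_independent_aug surj.
have hTD p : tor_independent phi theta (D p) (eq^~ 0) (eq^~ 0).
  case: p => [|p]; first exact: (tor_independent_next hphi pair_ideal ex0).
  exact: (tor_independent_next hphi (pair_zero _ _ (gd p)) (exS p)).
split.
- exact: (map_graded hphi hA).
- by move=> p; exact: (map_graded hphi (hD p)).
- exact: reduce_surj.
- exact: (reduce_exact hphi pair_ideal hT ex0).
- move=> p.
  exact: (reduce_exact hphi (pair_zero _ _ (gd p)) (hTD p) (exS p)).
- by move=> p i j; rewrite mxE (phi_const hphi).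
Qed.

(** The lift of each differential is chosen as generators of the kernel of the
    lift chosen before it, which calls for dependent choice along p. *)
Lemma lift_resolution rk gd A D : @is_ideal_resolution k n' J rk gd A D ->
  exists A' D', @is_ideal_resolution k n I rk gd A' D'.
Proof.
move=> [hA hD surj ex0 exS min].
have [A' hA' gA'] := lift_graded hphi hA.
have surj' : forall x : 'rV_1, exists u, in_ideal I (x - u *m A').
  by apply: (lift_surj gA'); rewrite hA'.
rewrite -hA' in ex0.
have [D0 [hD0 gD0 ex0']] :=
  lift_exact hphi gA' pair_ideal (tor_independent_aug surj') (hD 0%N) ex0.
pose P p (D' : 'M[S]_(rk p.+1, rk p)) :=
  [/\ D'^phi = D p, graded_mx (gd p.+1) (gd p) D' &
      tor_independent phi theta D' (eq^~ 0) (eq^~ 0)].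
have P0 : P 0%N D0.
  by split=> //; exact: (tor_independent_next hphi pair_ideal ex0').
pose R p (D' : 'M[S]_(rk p.+1, rk p)) (E : 'M[S]_(rk p.+2, rk p.+1)) :=
  forall u : 'rV_(rk p.+1), u *m D' = 0 <-> exists v, v *m E = u.
have step p D' : P p D' -> exists2 E, P p.+1 E & R p D' E.
  move=> [hD' gD' tD']; have exp := exS p; rewrite -hD' in exp.
  have [E [hE gE exE]] :=
    lift_exact hphi gD' (pair_zero _ _ (gd p)) tD' (hD p.+1) exp.
  exists E => //; split=> //.
  exact: (tor_independent_next hphi (pair_zero _ _ (gd p)) exE).
have [D' [D'0 PD' exD']] := dependent_choice_nat P0 step.
exists A', D'; split=> //; first by move=> p; have [] := PD' p.
  by rewrite D'0.
move=> p i j; rewrite -(phi_const hphi) -(min p i j).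
by have [<-] := PD' p; rewrite mxE.
Qed.

(** Reduction and lifting keep the ranks and the degrees, so that both Betti
    numbers are chosen from the same set. *)
Lemma betti_hyperplane_section p q :
  betti (@quot_gr k n I) p q = betti (@quot_gr k n' J) p q.
Proof.
rewrite !betti_ideal; congr (xget _ _); apply/seteqP; split=> b /=.
  move=> [rk [gd [A [D [/reduce_resolution hF ->]]]]].
  by exists rk, gd, A^phi, (fun p => (D p)^phi).
move=> [rk [gd [A [D [/lift_resolution[A' [D' hF]] ->]]]]].
by exists rk, gd, A', D'.
Qed.

End Towers.

(** * Edge ideals as monomial ideals *)

Section EdgeMonomials.
Variables (k : fieldType) (V : finType) (G : sgraph V).
Local Notation S := {mpoly k[#|V|]}.
Local Notation expo m v := ((m : 'X_{1..#|V|}) (enum_rank v)).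
Local Notation U v := (U_(enum_rank v))%MM.
Local Notation I := (@edge_ideal k _ G).

Definition edge_monomial (m : 'X_{1..#|V|}) : bool :=
  [exists u, exists v, [&& G u v, (0 < expo m u)%N & (0 < expo m v)%N]].

Lemma edge_monomialP m :
  reflect (exists u v, [/\ G u v, (0 < expo m u)%N & (0 < expo m v)%N])
          (edge_monomial m).
Proof.
apply: (iffP existsP) => [[u /existsP[v /and3P[]]]|[u [v [uv mu mv]]]].
  by exists u, v.
by exists u; apply/existsP; exists v; apply/and3P.
Qed.

Lemma U_at u v : (expo (U u) v) = (u == v).
Proof. by rewrite mnm1E (inj_eq enum_rank_inj). Qed.

Lemma mem_edge u v : G u v -> var k u * var k v \in I.
Proof.
move=> uv; apply/edge_idealP.
exists (fun e => if e == (u, v) then 1 else 0).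
rewrite (bigD1 (u, v)) //= eqxx mul1r big1 ?addr0 // => e /andP[_ /negbTE->].
by rewrite mul0r.
Qed.

Lemma edge_ideal_monomials (f : S) :
  f \in I <-> {in msupp f, forall m, edge_monomial m}.
Proof.
split=> [/edge_idealP[c ->]|If].
  pose P (g : S) := {in msupp g, forall m, edge_monomial m}.
  apply: (big_ind P) => [m|g g' Pg Pg' m|[u v] /= uv m].
  - by rewrite msupp0.
  - by move=> /msuppD_le; rewrite mem_cat => /orP[/Pg|/Pg'].
  rewrite /var -mpolyXD (perm_mem (msuppMX _ _)) => /mapP[m' _ ->].
  apply/edge_monomialP; exists u, v.
  by rewrite !mnmDE !U_at !eqxx !addn_gt0 ?orbT.
rewrite [f]mpolyE big_seq; apply: rpred_sum => m /If/edge_monomialP.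
move=> [u [v [uv mu mv]]].
have le_m : (U u + U v <= m)%MM.
  apply/mnm_lepP => i; rewrite -[i]enum_valK mnmDE !U_at.
  case: eqP => [<-|_]; last by case: eqP => [<-|_].
  by case: eqP uv => [->|_ _]; rewrite ?adj_irr // addn0.
rewrite -(submK le_m) mpolyXD mpolyXD -mul_mpolyC mulrA.
exact/idealMr/mem_edge.
Qed.

Lemma edge_ideal_graded e (f : S) : f \in I -> piece 0 e f \in I.
Proof.
rewrite !edge_ideal_monomials => If m; rewrite mcoeff_msupp mcoeff_piece.
by case: ifP; rewrite ?eqxx // -mcoeff_msupp => _; exact: If.
Qed.

Lemma mcoeff_mulX (f : S) v m :
  (var k v * f)@_m = if (0 < expo m v)%N then f@_(m - U v) else 0.
Proof.
rewrite mulrC /var; case: ifP => mv.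
  have le_m : (U v <= m)%MM.
    by apply/mnm_lepP => i; rewrite mnm1E; case: eqP => [<-|].
  by rewrite -{1}(submK le_m) addmC mcoeffMX.
apply: memN_msupp_eq0; rewrite (perm_mem (msuppMX _ _)).
by apply: contraFN mv => /mapP[m' _ ->]; rewrite mnmDE U_at eqxx.
Qed.

(** Descending induction on the exponent of a.  If m X_a is not in the ideal, its
    coefficient in (X_a - X_b) f vanishes, so that m2 = m X_a / X_b also occurs
    in f; the neighbours of a have the same exponents in m and m2, since b is
    not one of them.  If m X_a is in the ideal and m is not, then the edge
    dividing m X_a contains a. *)
Lemma neighbor_in_monomial a b (f : S) m : a != b -> ~~ G a b ->
  (var k a - var k b) * f \in I -> m \in msupp f -> ~~ edge_monomial m ->
  exists2 v, G a v & (0 < expo m v)%N.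
Proof.
move=> neq_ab nadj_ab /edge_ideal_monomials I_f.
have [d] := ubnP (msize f - expo m a)%N; elim: d m => // d IHd m le_d m_f m_ne.
have [|ma_ne] := boolP (edge_monomial (m + U a)).
  move=> /edge_monomialP[u [v [uv mu mv]]].
  have meet_a w w' : a = w -> G w w' -> (0 < (expo (m + U a)%MM w'))%N ->
      exists2 v, G a v & (0 < expo m v)%N.
    move=> <- aw'; rewrite mnmDE U_at; case: eqP => [def_w'|_].
      by rewrite -def_w' adj_irr in aw'.
    by rewrite addn0; exists w'.
  have [/meet_a/(_ uv mv)//|/eqP ne_u] := eqVneq a u.
  have [def_v|/eqP ne_v] := eqVneq a v.
    by apply: (meet_a _ _ def_v) mu; rewrite adj_sym.
  case/edge_monomialP: m_ne; exists u, v; move: mu mv.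
  by rewrite !mnmDE !U_at; do 2 case: eqP => // _; rewrite !addn0.
have : ((var k a - var k b) * f)@_(m + U a) = 0.
  by apply: memN_msupp_eq0; apply: contra ma_ne; exact: I_f.
rewrite mulrBl mcoeffB !mcoeff_mulX !mnmDE !U_at eqxx addn1 /= addmK.
rewrite (negbTE neq_ab) addn0; case: ifP => [mb|_]; last first.
  by move/eqP; rewrite subr0 -(negbK (_ == 0)) -mcoeff_msupp m_f.
pose m2 := (m + U a - U b)%MM => /eqP; rewrite subr_eq0 -/m2 => /eqP m2_f.
have m2E v : a != v -> b != v -> expo m2 v = expo m v.
  by move=> /negbTE av /negbTE bv; rewrite mnmBE mnmDE !U_at av bv addn0 subn0.
have m2a : expo m2 a = (expo m a).+1.
  by rewrite mnmBE mnmDE !U_at eqxx eq_sym (negbTE neq_ab) subn0 addn1.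
have m2K : (m2 + U b = m + U a)%MM.
  apply: submK; apply/mnm_lepP => i; rewrite mnm1E mnmDE.
  by case: eqP => [<-|//]; rewrite ltn_addr.
have m2_supp : m2 \in msupp f by rewrite mcoeff_msupp -m2_f -mcoeff_msupp.
have lt_ma : (expo m2 a < msize f)%N.
  apply: leq_ltn_trans (msize_mdeg_lt m2_supp).
  by rewrite mdegE (bigD1 (enum_rank a)) //= leq_addr.
have [|//||v av m2v] := IHd m2.
- rewrite m2a in lt_ma *.
  by rewrite subnS prednK ?subn_gt0 // ltnW.
- apply: contra ma_ne => /edge_monomialP[u [v [uv mu mv]]]; rewrite -m2K.
  by apply/edge_monomialP; exists u, v; rewrite !mnmDE !ltn_addr.
exists v => //; rewrite -m2E //;
  by apply: contraTneq av => <-; rewrite ?adj_irr.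
Qed.

(** A monomial of f outside the ideal would be divisible by a neighbour of a and
    by a neighbour of b; these two are adjacent, so it lies in the ideal. *)
Lemma edge_ideal_regular a b : a != b -> ~~ G a b ->
  (forall u v, G a u -> G b v -> G u v) ->
  forall f : S, (var k a - var k b) * f \in I -> f \in I.
Proof.
move=> neq_ab nadj_ab compl f I_f; apply/edge_ideal_monomials => m m_f.
apply: contraT => m_ne.
have [u au mu] := neighbor_in_monomial neq_ab nadj_ab I_f m_f m_ne.
have [v bv mv] : exists2 v, G b v & (0 < expo m v)%N.
  apply: (@neighbor_in_monomial b a f) => //; first by rewrite eq_sym.
    by rewrite adj_sym.
  by rewrite -opprB mulNr rpredN.
by case/edge_monomialP: m_ne; exists u, v; split=> //; exact: compl.
Qed.

End EdgeMonomials.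

(** * Identification of vertices *)

Lemma mpoly_ind_ring (k : fieldType) n (P : {mpoly k[n]} -> Prop) :
  (forall c, P c%:MP) -> (forall i, P 'X_i) ->
  (forall p q, P p -> P q -> P (p + q)) ->
  (forall p q, P p -> P q -> P (p * q)) -> forall p, P p.
Proof.
move=> PC PX PD PM; apply: mpoly_ind_linear => //; first by rewrite -mpolyC0.
move=> c m; rewrite -mul_mpolyC mpolyXE_id; apply: (PM) => //.
apply: (big_ind P) => [|//|i _]; first by rewrite -mpolyC1.
by elim: (m i) => [|d IHd]; [rewrite expr0 -mpolyC1 | rewrite exprS; exact: PM].
Qed.

Section Renaming.
Variables (k : fieldType) (V W : finType) (f : V -> W).
Local Notation S := {mpoly k[#|V|]}.
Local Notation T := {mpoly k[#|W|]}.

Definition rename : {rmorphism S -> T} :=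
  comp_mpoly [tuple var k (f (enum_val i)) | i < #|V|].

Lemma rename_var v : rename (var k v) = var k (f v).
Proof.
by rewrite /rename /var /= comp_mpolyXU -tnth_nth tnth_mktuple enum_rankK.
Qed.

Lemma renameC c : rename c%:MP = c%:MP.
Proof. exact: comp_mpolyC. Qed.

Lemma renameZ c p : rename (c *: p) = c *: rename p.
Proof. exact: comp_mpolyZ. Qed.

Lemma rename_monomial m :
  exists2 m', rename 'X_[m] = 'X_[m'] & mdeg m' = mdeg m.
Proof.
exists (\sum_i U_(enum_rank (f (enum_val i))) *+ m i)%MM.
  rewrite /rename /= comp_mpolyX -mprodXE; apply: eq_bigr => i _.
  by rewrite tnth_mktuple /var mpolyXn.
rewrite mdeg_sum mdegE; apply: eq_bigr => i _.
by rewrite mdegMn mdeg1 mul1n.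
Qed.

Lemma rename_piece a e p : rename (piece a e p) = piece a e (rename p).
Proof.
elim/mpoly_ind_linear: p => [|p q IHp IHq|c m].
- by rewrite linear0 !rmorph0 linear0.
- by rewrite linearD !rmorphD /= linearD IHp IHq.
rewrite linearZ /= !renameZ linearZ /= pieceX.
have [m' hm' dm'] := rename_monomial m.
by rewrite hm' pieceX dm'; case: ifP; rewrite ?hm' ?rmorph0.
Qed.

Lemma rename_const p : (rename p)@_0%MM = p@_0%MM.
Proof.
elim/mpoly_ind_linear: p => [|p q IHp IHq|c m].
- by rewrite rmorph0 !mcoeff0.
- by rewrite rmorphD !mcoeffD IHp IHq.
rewrite renameZ !mcoeffZ; have [m' -> dm'] := rename_monomial m.
by rewrite !mcoeffX -!mdeg_eq0 dm'.
Qed.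
End Renaming.

Section EdgeSpecialization.
Variables (k : fieldType) (V W : finType) (G : sgraph V) (K : sgraph W).
Variables (f : V -> W) (s : W -> V) (theta : {mpoly k[#|V|]}).
Hypotheses (fK : cancel s f)
  (f_hom : forall u v, G u v -> K (f u) (f v))
  (f_edge : forall x y, K x y -> exists u v, [/\ G u v, f u = x & f v = y]).
Hypotheses (theta_linear : has_shift 1 0 theta)
  (theta_f : rename k f theta = 0)
  (theta_s : forall v, exists g, var k v - var k (s (f v)) = theta * g).

(** Modulo theta, every variable is the one chosen by s in its fibre.  So
    rename s (rename f p) = p modulo theta, first for the variables and then for
    all p, and the kernel of rename f is generated by theta. *)
Lemma rename_hyperplane_section : is_hyperplane_section (rename k f) theta.
Proof.
have renameK g : rename k f (rename k s g) = g.
  elim/mpoly_ind_ring: g => [c|i|p q IHp IHq|p q IHp IHq].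
  - by rewrite !renameC.
  - by rewrite -[i]enum_valK !rename_var fK.
  - by rewrite !rmorphD IHp IHq.
  - by rewrite !rmorphM /= IHp IHq.
split=> //; [|exact: rename_piece|exact: rename_const|].
  by move=> g; exists (rename k s g).
have diff p : exists g, p - rename k s (rename k f p) = theta * g.
  elim/mpoly_ind_ring: p => [c|i|p q [g hg] [g' hg']|p q [g hg] [g' hg']].
  - by exists 0; rewrite !renameC subrr mulr0.
  - by rewrite -[i]enum_valK !rename_var; exact: theta_s.
  - by exists (g + g'); rewrite !rmorphD opprD addrACA hg hg' mulrDr.
  exists (g * q + rename k s (rename k f p) * g').
  by rewrite mulrDr mulrA -hg mulrCA -hg' mulrBl mulrBr !rmorphM /= addrA subrK.
move=> p p0; have [g hg] := diff p; exists g.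
by rewrite -hg p0 rmorph0 subr0.
Qed.

Lemma edge_ideal_image g :
  g \in edge_ideal K <-> exists2 p, p \in @edge_ideal k V G & rename k f p = g.
Proof.
split=> [/edge_idealP[c ->]|[p /edge_idealP[c ->] <-]].
  pose P g := exists2 p, p \in @edge_ideal k V G & rename k f p = g.
  apply: (big_ind P).
  - by exists 0; rewrite ?rpred0 ?rmorph0.
  - move=> _ _ [p Ip <-] [q Iq <-]; exists (p + q); first exact: rpredD.
    by rewrite rmorphD.
  move=> [x y] /= /f_edge[u [v [uv <- <-]]].
  have [d hd] := phi_surj rename_hyperplane_section (c (f u, f v)).
  exists (d * (var k u * var k v)); first exact/idealMr/mem_edge.
  by rewrite !rmorphM /= hd !rename_var.
rewrite rmorph_sum; apply: rpred_sum => -[u v] /= uv.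
by rewrite !rmorphM /= !rename_var; apply/idealMr/mem_edge/f_hom.
Qed.

Lemma betti_edge_specialization p q :
  (theta != 0 -> forall g, theta * g \in edge_ideal G -> g \in edge_ideal G) ->
  betti_edge_ring k G p q = betti_edge_ring k K p q.
Proof.
move=> reg.
apply: (betti_hyperplane_section rename_hyperplane_section) => //.
  by move=> e g; exact: edge_ideal_graded.
exact: edge_ideal_image.
Qed.
End EdgeSpecialization.

Section Identification.
Variable k : fieldType.

(** For each pair of distinct vertices a, b of a fibre, the condition that makes
    X_a - X_b regular modulo the edge ideal. *)
Definition separates (V W : finType) (G : sgraph V) (f : V -> W) : Prop :=
  forall a b u v, a != b -> f a = f b -> G a u -> G b v -> G u v.

Section IdentifyTwo.
Variables (V : finType) (G : sgraph V) (a b : V) (neq_ab : a != b).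
Definition merged : finType := {v : V | v != b}.
Definition merge (v : V) : merged := insubd (Sub a neq_ab : merged) v.

Lemma val_merge v : val (merge v) = if v == b then a else v.
Proof. by rewrite val_insubd; case: (v == b). Qed.

Lemma mergeK : cancel val merge.
Proof. exact: valKd. Qed.

Lemma merge_eq u v : merge u = merge v ->
  [\/ u = v, u = a /\ v = b | u = b /\ v = a].
Proof.
move/(congr1 val); rewrite !val_merge.
case: eqP => [->|_]; case: eqP => [->|_].
- by constructor 1.
- by move<-; constructor 3.
- by move->; constructor 2.
- by constructor 1.
Qed.

Definition merge_adj : rel merged := fun x y =>
  [exists u, exists v, [&& G u v, merge u == x & merge v == y]].

Lemma merge_adjP x y :
  reflect (exists u v, [/\ G u v, merge u = x & merge v = y]) (merge_adj x y).
Proof.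
apply: (iffP existsP) => [[u /existsP[v /and3P[uv /eqP ux /eqP vy]]]|].
  by exists u, v.
move=> [u [v [uv ux vy]]]; exists u; apply/existsP; exists v.
by rewrite uv ux vy !eqxx.
Qed.

Lemma merge_adj_sym : ssrbool.symmetric merge_adj.
Proof.
move=> x y; apply/merge_adjP/merge_adjP => -[u [v [uv ux vy]]];
  by exists v, u; rewrite adj_sym.
Qed.

Hypothesis nadj_ab : ~~ G a b.

Lemma merge_adj_irr : irreflexive merge_adj.
Proof.
move=> x; apply/merge_adjP => -[u [v [uv <- /merge_eq]]].
move=> [def|[def def']|[def def']].
- by rewrite def adj_irr in uv.
- by rewrite def def' adj_sym (negbTE nadj_ab) in uv.
- by rewrite def def' (negbTE nadj_ab) in uv.
Qed.

Definition merge_graph : sgraph merged := SGraph merge_adj_sym merge_adj_irr.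

Lemma betti_merge p q : (forall u v, G a u -> G b v -> G u v) ->
  betti_edge_ring k G p q = betti_edge_ring k merge_graph p q.
Proof.
move=> compl.
have merge_ab : merge a = merge b.
  by apply: val_inj; rewrite !val_merge eqxx (negbTE neq_ab).
apply: (@betti_edge_specialization k V merged G merge_graph merge val
  (var k a - var k b)).
- exact: mergeK.
- by move=> u v uv; apply/merge_adjP; exists u, v.
- by move=> x y /merge_adjP.
- have var_linear (v : V) : has_shift 1 0 (var k v).
    by move=> m; rewrite msuppX inE => /eqP->; rewrite mdeg1.
  apply/has_shiftP; rewrite linearB /=.
  by have /has_shiftP-> := var_linear a; have /has_shiftP-> := var_linear b.
- by rewrite rmorphB /= !rename_var merge_ab subrr.
- move=> v; rewrite val_merge; case: eqP => [->|_].
    by exists (-1); rewrite mulrN1 opprB.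
  by exists 0; rewrite subrr mulr0.
- by move=> _ g; exact: edge_ideal_regular.
Qed.
End IdentifyTwo.

(** Two vertices of the same fibre are merged, and f factors through the merged
    graph.  An edge of that graph comes from an edge of G and f does not see the
    merging, so the hypotheses are inherited, until f is a bijection. *)
Lemma betti_identification (V W : finType) (G : sgraph V) (K : sgraph W)
    (f : V -> W) p q :
  (forall w, exists v, f v = w) ->
  (forall u v, G u v -> K (f u) (f v)) ->
  (forall x y, K x y -> exists u v, [/\ G u v, f u = x & f v = y]) ->
  separates G f ->
  betti_edge_ring k G p q = betti_edge_ring k K p q.
Proof.
have [d] := ubnP #|V|; elim: d V G f => // d IHd V G f le_d surj hom edge sep.
have [/injectiveP inj|] := boolP (injectiveb f).
  have [s fs] := choice surj.
  apply: (@betti_edge_specialization k V W G K f s 0) => //.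
  - by move=> m; rewrite msupp0.
  - by rewrite rmorph0.
  - by move=> v; exists 0; rewrite mulr0 (inj _ _ (fs (f v))) subrr.
  - by rewrite eqxx.
move=> /injectivePn[a [b neq_ab eq_fab]].
have nadj_ab : ~~ G a b.
  by apply/negP => /hom; rewrite eq_fab adj_irr.
rewrite (@betti_merge V G a b neq_ab nadj_ab p q); last first.
  by move=> u v; exact: sep neq_ab eq_fab.
have f_merge v : f (val (merge neq_ab v)) = f v.
  by rewrite val_merge; case: eqP => [->|].
apply: (IHd _ _ (f \o val)).
- rewrite card_sig; apply: (@leq_trans #|V|); last by rewrite -ltnS.
  apply: proper_card; apply/properP; split; first exact: subset_predT.
  by exists b; rewrite ?inE ?eqxx.
- by move=> w; have [v <-] := surj w; exists (merge neq_ab v); exact: f_merge.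
- by move=> x y /merge_adjP[u [v [uv <- <-]]]; rewrite /= !f_merge; exact: hom.
- move=> x y /edge[u [v [uv <- <-]]]; exists (merge neq_ab u), (merge neq_ab v).
  by split; rewrite /= ?f_merge //; apply/merge_adjP; exists u, v.
move=> x y z t neq_xy /= eq_f /merge_adjP[u [u' [uu' def_x <-]]].
move=> /merge_adjP[v [v' [vv' def_y <-]]].
apply/merge_adjP; exists u', v'; split=> //; apply: (sep u v) => //.
  by apply: contraNneq neq_xy => eq_uv; rewrite -def_x -def_y eq_uv.
by rewrite -f_merge -(f_merge v) def_x def_y.
Qed.
End Identification.

Local Close Scope ring_scope.

(** * The folding of the multi-whisker graph onto the corona *)

Section Corona.
Variables (h : nat) (G : sgraph 'I_h) (n : 'I_h -> nat).
Variables (m : clique_index n -> nat) (m_gt0 : forall c, 0 < m c).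

Definition last_vertex (c : clique_index n) : clique_vertex m :=
  Tagged (fun c => 'I_(m c))
    (Ordinal (eq_leq (prednK (m_gt0 c)) : (m c).-1 < m c)).

Definition fold_whisker (v : whisker_vertex m) : corona_vertex m :=
  match v with
  | inl a => val a
  | inr z => inr (last_vertex (tag z))
  end.

Lemma clique_vertex_inj (y y' : clique_vertex m) :
  tag y = tag y' -> tagged y = tagged y' :> nat -> y = y'.
Proof.
case: y y' => [c i] [c' i'] /= eq_c; case: c' / eq_c i' => i' /= eq_i.
by congr Tagged; apply: val_inj.
Qed.

Lemma last_vertexP (v : corona_vertex m) :
  reflect (exists c, v = inr (last_vertex c)) (v \in last_vertices m).
Proof.
rewrite inE; case: v => [i|y] /=; first by apply: ReflectF => -[].
apply: (iffP eqP) => [def_y|[c [->]]]; last by rewrite /= prednK.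
exists (tag y); congr inr; apply: clique_vertex_inj => //=.
exact: (congr1 predn def_y).
Qed.

Definition new_vertex (c : clique_index n) (k : nat) (lt_k : k < m c) :
  whisker_vertex m := inr (Tagged (fun c => 'I_(m c)) (Ordinal lt_k)).

Lemma fold_whisker_surj w : exists v, fold_whisker v = w.
Proof.
have [/last_vertexP[c ->]|w_nlast] := boolP (w \in last_vertices m).
  by exists (new_vertex (m_gt0 c)).
by exists (inl (Sub w w_nlast)).
Qed.

Lemma pendant_last (v : corona_vertex m) z : v \notin last_vertices m ->
  pendant v z -> corona G m v (inr (last_vertex (tag z))).
Proof.
case: v => [i _ /andP[]//|y] y_nlast /andP[eq_c _] /=.
rewrite eq_c; apply: contraNneq y_nlast => ->.
by apply/last_vertexP; exists (tag z).
Qed.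

Lemma fold_whisker_hom u v : whisker G m u v ->
  corona G m (fold_whisker u) (fold_whisker v).
Proof.
case: u v => [[u u_nlast]|z] [[v v_nlast]|z'] //=; first exact: pendant_last.
by move=> /(pendant_last v_nlast); rewrite adj_sym.
Qed.

Lemma fold_whisker_edge x y : corona G m x y -> exists u v,
  [/\ whisker G m u v, fold_whisker u = x & fold_whisker v = y].
Proof.
have edge_last v c : v \notin last_vertices m ->
    corona G m v (inr (last_vertex c)) ->
    exists u w, [/\ whisker G m u w, fold_whisker u = v &
      fold_whisker w = inr (last_vertex c)].
  case: v => [i|y'] v_nlast.
    move=> /= adj_i; exists (inl (Sub (inl i : corona_vertex m) v_nlast)).
    by exists (new_vertex (m_gt0 c)); rewrite /= /pendant /= adj_i.
  move=> /= /andP[/eqP eq_c _]; case: c / eq_c.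
  have lt_y : (tagged y').+1 < m (tag y').
    by rewrite ltn_neqAle ltn_ord andbT; move: v_nlast; rewrite inE.
  exists (inl (Sub (inr y' : corona_vertex m) v_nlast)), (new_vertex lt_y).
  by rewrite /= !eqxx.
have [/last_vertexP[c ->]|x_nlast] := boolP (x \in last_vertices m); last first.
  have [/last_vertexP[c ->]|y_nlast] := boolP (y \in last_vertices m).
    exact: edge_last.
  by move=> xy; exists (inl (Sub x x_nlast)), (inl (Sub y y_nlast)).
have [/last_vertexP[c' ->]|y_nlast] := boolP (y \in last_vertices m).
  by move=> /= /andP[/eqP ->]; rewrite eqxx.
rewrite adj_sym => /(edge_last _ _ y_nlast)[u [v [uv u_y v_x]]].
by exists v, u; rewrite adj_sym.
Qed.

(** Distinct whiskers of one fibre hang from distinct vertices of the clique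
    formed by x_i and the vertices of H_i^j. *)
Lemma fold_whisker_separates : separates (whisker G m) fold_whisker.
Proof.
have val_neq_last (a : {v : corona_vertex m | v \notin last_vertices m}) c :
    val a <> inr (last_vertex c).
  by move=> def_a; have /last_vertexP[] := valP a; exists c.
move=> [a|z] [b|z'] u v neq_ab /=.
- by move=> /val_inj eq_ab; rewrite eq_ab eqxx in neq_ab.
- by move=> /val_neq_last.
- by move=> /esym/val_neq_last.
pose clique_of (w : corona_vertex m) := if w is inr y then tag y else tag z.
move=> /(congr1 clique_of) /= eq_c; case: u => [u|//]; case: v => [v|//].
have neq_k : tagged z != tagged z' :> nat.
  by apply: contraNneq neq_ab => eq_k; rewrite (clique_vertex_inj eq_c eq_k).
case: u v => [[i|y] u_nlast] [[i'|y'] v_nlast] /=; rewrite /pendant /=.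
- by move=> /andP[_ /eqP z0] /andP[_ /eqP z'0]; rewrite z0 z'0 in neq_k.
- by move=> /andP[/eqP<- _] /andP[/eqP eq_y' _]; rewrite eq_y' eq_c.
- by move=> /andP[/eqP eq_y _] /andP[/eqP<- _]; rewrite eq_y eq_c.
move=> /andP[/eqP eq_y /eqP def_z] /andP[/eqP eq_y' /eqP def_z'].
rewrite eq_y eq_y' eq_c eqxx /=; apply: contraNneq neq_k => def_y.
by rewrite -def_z -def_z' def_y.
Qed.
End Corona.

Theorem theorem5p5 (k : fieldType) (h : nat) (G : sgraph 'I_h)
    (n : 'I_h -> nat) (m : {i : 'I_h & 'I_(n i)} -> nat)
    (n_gt0 : forall i, 0 < n i) (m_gt0 : forall c, 0 < m c) (p q : nat) :
  betti_edge_ring k (corona G m) p q = betti_edge_ring k (whisker G m) p q.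
Proof.
apply/esym/(@betti_identification k _ _ _ _ (@fold_whisker h n m m_gt0)).
- exact: fold_whisker_surj.
- exact: fold_whisker_hom.
- exact: fold_whisker_edge.
- exact: fold_whisker_separates.
Qed.
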